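(* Let $a,b$ be positive coprime integers, and let $c=ab-a-b$. Then the harmonic diagram of $\mathrm{H}(a,b,c)$, i.e. the diagram obtained by projecting the curve $x=T_a(t)$, $y=T_b(t)$, $z=T_c(t)$ ($t\in\mathbf{R}$) onto the $(x,y)$-plane with over/under information given by the height $z$, is alternating.
   Context: $T_n$ denotes the Chebyshev polynomials: $T_0=1$, $T_1=t$, $T_{n+1}=2tT_n-T_{n-1}$ for $n\in\mathbf{Z}$, so that $\cos(n\theta)=T_n(\cos\theta)$ (in particular $T_{-n}=T_n$). For pairwise coprime integers $a,b,c$, the harmonic knot $\mathrm{H}(a,b,c)$ is the nonsingular space curve $x=T_a(t)$, $y=T_b(t)$, $z=T_c(t)$, $t\in\mathbf{R}$, regarded as a knot in $\mathbf{S}^3=\mathbf{R}^3\cup\{\infty\}$ by adding the point at infinity. A diagram is alternating if over- and under-crossings alternate as one travels along the curve. *)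

(* Defs.v *)
From HB Require Import structures.
From mathcomp Require Import all_boot all_order all_algebra.
From mathcomp Require Import all_classical reals.

Set Implicit Arguments.
Unset Strict Implicit.
Unset Printing Implicit Defensive.

Import Order.TTheory GRing.Theory Num.Theory.

Local Open Scope classical_set_scope.
Local Open Scope ring_scope.

Fixpoint chebyshev_nat (R : nzRingType) (n : nat) : {poly R} :=
  match n with
  | 0 => 1
  | 1 => 'X
  | (m.+1 as k).+1 => 2%:R * 'X * chebyshev_nat R k - chebyshev_nat R m
  end.

(* The recurrence run backwards from T_0 = 1, T_1 = 'X gives T_(-n) = T_n;
   [chebyshevS] checks it over all of int. *)
Definition chebyshev (R : nzRingType) (n : int) : {poly R} :=
  chebyshev_nat R `|n|%N.

Lemma chebyshev0 (R : nzRingType) : chebyshev R 0 = 1.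
Proof. by []. Qed.

Lemma chebyshev1 (R : nzRingType) : chebyshev R 1 = 'X.
Proof. by []. Qed.

Lemma chebyshevS (R : nzRingType) (n : int) :
  chebyshev R (n + 1) = 2%:R * 'X * chebyshev R n - chebyshev R (n - 1).
Proof.
have rec k : chebyshev_nat R k.+2 =
  2%:R * 'X * chebyshev_nat R k.+1 - chebyshev_nat R k by [].
case: n => [[|k]|k].
- rewrite /chebyshev /= mulr1 mulrDl mul1r.
  by rewrite -addrA subrr addr0.
- have -> : Posz k.+1 + 1 = Posz k.+2 by rewrite -PoszD addn1.
  have -> : Posz k.+1 - 1 = Posz k by rewrite -addn1 PoszD addrK.
  exact: rec.
- have -> : Negz k + 1 = - Posz k by rewrite NegzE -addn1 PoszD opprD addrNK.
  have -> : Negz k - 1 = - Posz k.+2 by rewrite NegzE -opprD -PoszD addn1.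
  by rewrite NegzE /chebyshev !abszN !absz_nat rec subKr.
Qed.

Record poly_curve (R : realType) := PolyCurve {
  curve_x : {poly R};
  curve_y : {poly R};
  curve_z : {poly R}
}.

Definition harmonic_curve (R : realType) (a b c : int) : poly_curve R :=
  PolyCurve (chebyshev R a) (chebyshev R b) (chebyshev R c).

Section Diagram.
Variables (R : realType) (K : poly_curve R).

Definition double_point (s t : R) : Prop :=
  [/\ s != t, (curve_x K).[s] = (curve_x K).[t]
    & (curve_y K).[s] = (curve_y K).[t]].

(* Each crossing of the diagram is passed at two elements of this set. *)
Definition crossing_params : set R := [set t | exists s, double_point s t].

Record regular_diagram : Prop := RegularDiagram {
  diagram_immersed : forall t : R,
    ~ ((curve_x K)^`().[t] = 0 /\ (curve_y K)^`().[t] = 0);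
  diagram_finite : finite_set crossing_params;
  diagram_no_triple : forall s s' t : R,
    double_point s t -> double_point s' t -> s = s';
  diagram_transverse : forall s t : R, double_point s t ->
    (curve_x K)^`().[s] * (curve_y K)^`().[t]
      != (curve_x K)^`().[t] * (curve_y K)^`().[s];
  diagram_heights : forall s t : R, double_point s t ->
    (curve_z K).[s] != (curve_z K).[t]
}.

Definition over_at (t : R) : Prop :=
  exists2 s, double_point s t & (curve_z K).[s] < (curve_z K).[t].

Definition under_at (t : R) : Prop :=
  exists2 s, double_point s t & (curve_z K).[t] < (curve_z K).[s].

(* u lies strictly inside the arc travelled from t to t' on the closed curve;
   when t' <= t this arc goes through the point at infinity. *)
Definition on_arc (t t' u : R) : bool :=
  if t < t' then (t < u) && (u < t') else (t < u) || (u < t').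

Definition consecutive_crossings (t t' : R) : Prop :=
  [/\ crossing_params t, crossing_params t'
    & forall u, crossing_params u -> ~~ on_arc t t' u].

Definition alternating : Prop :=
  forall t t', consecutive_crossings t t' -> (over_at t <-> under_at t').

(* Over/under information only makes sense on a regular projection, so
   regularity is part of being an alternating diagram. *)
Definition alternating_diagram : Prop := regular_diagram /\ alternating.

End Diagram.

(* Main.v *)
(* Put t = cos u. The T_n with n > 0 are strictly monotone in |t| beyond 1, so
   all double points lie in [-1, 1], and s = cos v, t = cos u is one exactly
   when, up to the sign of v, both a (v + u) and b (v - u) are multiples of
   2 pi. Hence the crossing parameters are the cos (k pi / (a b)) with
   0 < k < a b and k divisible by neither a nor b. As
   c u = k pi - a u - b u, the height gap between the two branches is
   -2 (-1)^k sin (k pi / a) sin (k pi / b), so the branch at k is the upper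
   one iff k + floor (k / a) + floor (k / b) is odd. This parity flips at each
   crossing index and is unchanged at multiples of a or b; it is even at
   k = 0 and at k = a b - 1, which settles the arc through infinity. *)
Require Import Defs.
From mathcomp Require Import all_boot all_order all_algebra.
From mathcomp Require Import all_classical reals.
From mathcomp Require Import trigo.
From mathcomp Require Import zify ring lra.

Set Implicit Arguments.
Unset Strict Implicit.
Unset Printing Implicit Defensive.

Import Order.TTheory GRing.Theory Num.Theory.

Local Open Scope classical_set_scope.
Local Open Scope ring_scope.

(** * Multiples of 2 pi, zeros of the sine and coincidences of the cosine *)

Section Periods.
Variable R : realType.
Implicit Types x y u v : R.

Definition period2pi x := exists q : int, x = q%:~R * (pi *+ 2).

Lemma period2pi_intM (m : int) x : period2pi x -> period2pi (m%:~R * x).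
Proof. by case=> q ->; exists (m * q); rewrite intrM mulrA. Qed.

Lemma period2piD x y : period2pi x -> period2pi y -> period2pi (x + y).
Proof. by case=> q -> [r ->]; exists (q + r); rewrite intrD mulrDl. Qed.

Lemma period2piN x : period2pi x -> period2pi (- x).
Proof. by case=> q ->; exists (- q); rewrite intrN mulNr. Qed.

Lemma period2piB x y : period2pi x -> period2pi y -> period2pi (x - y).
Proof. by move=> px /period2piN; exact: period2piD. Qed.

(** By Bezout, [x] is an integer combination of [a x] and [b x]. Most uses of coprimality below go
    through this. *)
Lemma period2pi_coprime (a b : nat) x : coprime a b ->
  period2pi (a%:R * x) -> period2pi (b%:R * x) -> period2pi x.
Proof.
move=> ab pa pb; have /coprimezP[[u v] /= uv] : coprimez a b by [].
have -> : x = u%:~R * (a%:R * x) + v%:~R * (b%:R * x).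
  by rewrite !mulrA -mulrDl -[a%:R]/(a%:~R) -[b%:R]/(b%:~R) -!intrM -intrD uv mul1r.
by apply: period2piD; exact: period2pi_intM.
Qed.

Lemma cosD_natpi n x : cos (x + n%:R * pi) = (-1) ^+ n * cos x.
Proof. by rewrite mulr_natl alternatingn //; exact: cosDpi. Qed.

Lemma sinD_natpi n x : sin (x + n%:R * pi) = (-1) ^+ n * sin x.
Proof. by rewrite mulr_natl alternatingn //; exact: sinDpi. Qed.

Lemma cosD_intpi (k : int) x : cos (x + k%:~R * pi) = (-1) ^+ `|k|%N * cos x.
Proof.
case: (intP k) => [|n|n]; first by rewrite mul0r addr0 mul1r.
  exact: cosD_natpi.
rewrite abszN absz_nat intrN mulNr -[in RHS](subrK (n.+1%:R * pi) x) cosD_natpi.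
by rewrite mulrA -expr2 sqrr_sign mul1r.
Qed.

Lemma sinD_intpi (k : int) x : sin (x + k%:~R * pi) = (-1) ^+ `|k|%N * sin x.
Proof.
case: (intP k) => [|n|n]; first by rewrite mul0r addr0 mul1r.
  exact: sinD_natpi.
rewrite abszN absz_nat intrN mulNr -[in RHS](subrK (n.+1%:R * pi) x) sinD_natpi.
by rewrite mulrA -expr2 sqrr_sign mul1r.
Qed.

Lemma period2pi_intpi x : period2pi x ->
  exists2 k : int, x = k%:~R * pi & ~~ odd `|k|.
Proof.
case=> q ->; exists (q * 2); last by rewrite abszM oddM andbF.
by rewrite intrM -mulrA mulr_natl.
Qed.

Lemma cosD_period x u : period2pi u -> cos (x + u) = cos x.
Proof.
by case/period2pi_intpi=> k -> ek; rewrite cosD_intpi -signr_odd (negPf ek) mul1r.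
Qed.

Lemma sinD_period x u : period2pi u -> sin (x + u) = sin x.
Proof.
by case/period2pi_intpi=> k -> ek; rewrite sinD_intpi -signr_odd (negPf ek) mul1r.
Qed.

(** Subtracting [floor (x / pi)] times pi moves [x] into [0, pi), where the sine is positive except
    at 0. *)
Lemma sin_eq0_intpi x : sin x = 0 -> exists k : int, x = k%:~R * pi.
Proof.
move=> sx; have pi0 : 0 < pi :> R := pi_gt0 R.
pose k := Num.floor (x / pi); exists k.
have /andP[kx xk] : k%:~R <= x / pi < (k + 1)%:~R := floor_itv (x / pi).
have {}kx : 0 <= x - k%:~R * pi by rewrite subr_ge0 -ler_pdivlMr.
have {}xk : x - k%:~R * pi < pi.
  by rewrite ltrBlDl -{2}[pi]mul1r -mulrDl -ltr_pdivrMr // -[1]/(1%:~R) -intrD.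
apply/eqP; rewrite -subr_eq0 eq_le kx andbT leNgt; apply/negP => x0.
have := @sin_gt0_pi R (x - k%:~R * pi); rewrite x0 xk => /(_ isT).
rewrite -mulNr -intrN sinD_intpi sx mulr0 ltxx; exact.
Qed.

Lemma sin_intpi (k : int) : sin (k%:~R * pi) = 0 :> R.
Proof. by rewrite -[_ * _]add0r sinD_intpi sin0 mulr0. Qed.

(** Doubling turns multiples of pi into periods, so that zeros of the sine can be fed to the Bezout
    argument. *)
Lemma sin_eq0_period x : sin x = 0 <-> period2pi (x *+ 2).
Proof.
split=> [/sin_eq0_intpi[k ->]|[k]]; first by exists k; rewrite -mulrnAr.
rewrite [_ * (_ *+ 2)]mulrnAr => /pmulrnI -> //; exact: sin_intpi.
Qed.

(** The difference of the cosines is -2 times the product of the sines of the half-sum and the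
    half-difference. *)
Lemma cos_eq_period x y :
  cos x = cos y <-> period2pi (x + y) \/ period2pi (x - y).
Proof.
split=> [xy|[p|p]]; last 2 first.
- by rewrite -[RHS]cosN -(cosD_period (- y) p) [x + y]addrC addKr.
- by rewrite -(cosD_period y p) addrC subrK.
have : sin ((x + y) / 2) * sin ((x - y) / 2) = 0.
  have ex : x = (x + y) / 2 + (x - y) / 2 by field.
  have ey : y = (x + y) / 2 - (x - y) / 2 by field.
  by move: xy; rewrite [in cos x]ex [in cos y]ey cosD cosB; lra.
by move/eqP; rewrite mulf_eq0 => /orP[] /eqP /sin_eq0_period;
  rewrite mulr2n -splitr; [left | right].
Qed.

End Periods.

(** * Chebyshev polynomials: trigonometric form on [-1, 1] and growth beyond it *)

Section Chebyshev.
Variable R : realType.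
Implicit Types s t x : R.
Local Notation T := (chebyshev_nat R).

Lemma chebyshev_nat_rec n : T n.+2 = 2%:R * 'X * T n.+1 - T n.
Proof. by []. Qed.

Lemma horner_chebyshev_rec n t :
  (T n.+2).[t] = 2 * t * (T n.+1).[t] - (T n).[t].
Proof.
rewrite chebyshev_nat_rec hornerD hornerN hornerM -polyC_natr hornerM.
by rewrite hornerC hornerX.
Qed.

Lemma horner_deriv_chebyshev_rec n t : (T n.+2)^`().[t] =
  2 * (T n.+1).[t] + 2 * t * (T n.+1)^`().[t] - (T n)^`().[t].
Proof.
rewrite chebyshev_nat_rec -polyC_natr -mulrA mul_polyC.
by rewrite derivB derivZ derivM derivX !(hornerE, hornerM); ring.
Qed.

Lemma chebyshev_nat_cos n x : (T n).[cos x] = cos (n%:R * x).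
Proof.
elim/ltn_ind: n => -[|[|n]] IH; first by rewrite /= hornerC mul0r cos0.
  by rewrite /= hornerX mul1r.
rewrite horner_chebyshev_rec !IH //.
have -> : n.+2%:R * x = n.+1%:R * x + x by rewrite -[n.+2]addn1 natrD mulrDl mul1r.
have -> : n%:R * x = n.+1%:R * x - x by rewrite -addn1 natrD mulrDl mul1r addrK.
by rewrite cosB cosD; ring.
Qed.

Lemma chebyshev_cos (n : int) x : (chebyshev R n).[cos x] = cos (n%:~R * x).
Proof.
rewrite /chebyshev chebyshev_nat_cos; case: (intP n) => // k.
by rewrite abszN intrN mulNr cosN.
Qed.

(** The derivative of [cos (n x)] by the chain rule, obtained from the recurrence instead; keeping
    the factor [sin x] avoids a division at t = 1 and t = -1. *)
Lemma deriv_chebyshev_cos n x : (T n)^`().[cos x] * sin x = n%:R * sin (n%:R * x).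
Proof.
elim/ltn_ind: n => -[|[|n]] IH.
- by rewrite /= derivC horner0 !mul0r.
- by rewrite /= derivX hornerC !mul1r.
rewrite horner_deriv_chebyshev_rec chebyshev_nat_cos.
have -> (p q r : R) : (p + 2 * cos x * q - r) * sin x =
  p * sin x + 2 * cos x * (q * sin x) - r * sin x by ring.
rewrite !IH //.
have -> : n.+2%:R * x = n.+1%:R * x + x by rewrite -[n.+2]addn1 natrD mulrDl mul1r.
have -> : n%:R * x = n.+1%:R * x - x by rewrite -addn1 natrD mulrDl mul1r addrK.
by rewrite sinB sinD -[n.+2]addn2 -[n.+1]addn1 !natrD; ring.
Qed.

Lemma chebyshev_natN n t : (T n).[- t] = (-1) ^+ n * (T n).[t].
Proof.
elim/ltn_ind: n => -[|[|n]] IH; first by rewrite /= !hornerC mul1r.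
  by rewrite /= !hornerX mulN1r.
by rewrite !horner_chebyshev_rec !IH // !exprS; ring.
Qed.

Lemma deriv_chebyshev_natN n t : (T n)^`().[- t] = (-1) ^+ n.+1 * (T n)^`().[t].
Proof.
elim/ltn_ind: n => -[|[|n]] IH; first by rewrite /= derivC !horner0 mulr0.
  by rewrite /= derivX !hornerC -signr_odd mul1r.
by rewrite !horner_deriv_chebyshev_rec !IH // chebyshev_natN !exprS; ring.
Qed.

(* Solves both the recurrence of the differences [T n t - T n s], with
   [d = t - s], and that of the derivatives, with [d = 1] and [s = t]. *)
Lemma chebyshev_rec_growth (E p : nat -> R) (d s : R) :
    0 < d -> 1 <= s -> (forall n, 0 <= p n) ->
    E 0 = 0 -> E 1 = d ->
    (forall n, E n.+2 = 2 * d * p n.+1 + 2 * s * E n.+1 - E n) ->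
  forall n, 0 <= E n < E n.+1.
Proof.
move=> d0 s1 p0 E0 E1 EE; elim=> [|n /andP[En EnS]]; first by rewrite E0 E1 lexx.
have dp : 0 <= d * p n.+1 by rewrite mulr_ge0 // ltW.
have sE : 0 <= (s - 1) * E n.+1 by rewrite mulr_ge0 ?subr_ge0 //; lra.
apply/andP; split; first by lra.
rewrite EE; nra.
Qed.

Lemma chebyshev_nat_ge1 n t : 1 <= t -> 1 <= (T n).[t].
Proof.
(* The induction needs monotonicity in [n] as well, since the recurrence subtracts [T n]. *)
move=> t1; suff /andP[] : 1 <= (T n).[t] <= (T n.+1).[t] by [].
elim: n => [|n /andP[Tn TnS]]; first by rewrite /= hornerC hornerX lexx.
have sT : 0 <= (t - 1) * (T n.+1).[t] by rewrite mulr_ge0 ?subr_ge0 //; lra.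
by rewrite horner_chebyshev_rec; apply/andP; split; nra.
Qed.

Lemma chebyshev_nat_lt n s t : (0 < n)%N -> 1 <= s -> s < t ->
  (T n).[s] < (T n).[t].
Proof.
case: n => // n _ s1 st; have t1 : 1 <= t by lra.
have := @chebyshev_rec_growth (fun k => (T k).[t] - (T k).[s])
  (fun k => (T k).[t]) (t - s) s.
move=> /(_ _ s1 _ _ _ _ n)/andP[].
- by rewrite subr_gt0.
- by move=> k; apply: le_trans (chebyshev_nat_ge1 k t1).
- by rewrite /= !hornerC subrr.
- by rewrite /= !hornerX.
- by move=> k; rewrite !horner_chebyshev_rec; ring.
- by lra.
Qed.

Lemma deriv_chebyshev_gt0 n t : (0 < n)%N -> 1 <= t -> 0 < (T n)^`().[t].
Proof.
case: n => // n _ t1.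
have := @chebyshev_rec_growth (fun k => (T k)^`().[t]) (fun k => (T k).[t]) 1 t.
move=> /(_ _ t1 _ _ _ _ n)/andP[] //.
- by move=> k; apply: le_trans (chebyshev_nat_ge1 k t1).
- by rewrite /= derivC horner0.
- by rewrite /= derivX hornerC.
- by move=> k; rewrite horner_deriv_chebyshev_rec mulr1.
- by lra.
Qed.

Lemma normr_chebyshev_nat n t : `|(T n).[t]| = `|(T n).[`|t|]|.
Proof.
by have [t0|t0] := ger0P t; rewrite // chebyshev_natN normrM normrX normrN1 expr1n mul1r.
Qed.

Lemma deriv_chebyshev_neq0 n t : (0 < n)%N -> 1 <= `|t| -> (T n)^`().[t] != 0.
Proof.
move=> n0 t1; have := deriv_chebyshev_gt0 n0 t1; rewrite lt0r => /andP[+ _].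
have [t0|t0] := ger0P t; first by [].
by rewrite deriv_chebyshev_natN mulf_eq0 signr_eq0.
Qed.

(** If [|s| <= 1], then [s] gives a value of modulus at most 1, while [t] gives one of modulus above
    1; otherwise strict monotonicity on [1, oo) applies to the absolute values. *)
Lemma normr_chebyshev_inj n s t : (0 < n)%N -> 1 < `|t| ->
  (T n).[s] = (T n).[t] -> `|s| = `|t|.
Proof.
move=> n0 t1 st; have := congr1 (fun y : R => `|y|) st.
rewrite normr_chebyshev_nat [in RHS]normr_chebyshev_nat.
rewrite [RHS]ger0_norm; last by apply: le_trans (chebyshev_nat_ge1 n (ltW t1)).
have [s1|s1] := leP `|s| 1.
  have /acos_def[_ <-] : -1 <= `|s| <= 1 by have := normr_ge0 s; lra.
  have := chebyshev_nat_lt n0 (lexx 1) t1; have := cos_max (n%:R * acos `|s|).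
  have := chebyshev_nat_ge1 n (lexx 1).
  by rewrite chebyshev_nat_cos; lra.
rewrite ger0_norm; last by apply: le_trans (chebyshev_nat_ge1 n (ltW s1)).
have [lt|lt|//] := ltgtP `|s| `|t|.
  by have := chebyshev_nat_lt n0 (ltW s1) lt; lra.
by have := chebyshev_nat_lt n0 (ltW t1) lt; lra.
Qed.

(** For odd [n] the equality would make [t] a zero of [T n], but no zero lies beyond 1. *)
Lemma chebyshev_nat_eqN n t : 1 < `|t| -> (T n).[- t] = (T n).[t] -> ~~ odd n.
Proof.
move=> t1 /eqP; rewrite chebyshev_natN -signr_odd; case: (odd n) => //.
rewrite expr1 mulN1r eqNr -normr_eq0 normr_chebyshev_nat normr_eq0 => /eqP T0.
by have := chebyshev_nat_ge1 n (ltW t1); rewrite T0 ler10.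
Qed.

End Chebyshev.

(** * Double points of the harmonic curve as pairs of angles *)

Section HarmonicDiagram.
Variables (R : realType) (a b : nat).
Hypotheses (a_gt0 : (0 < a)%N) (b_gt0 : (0 < b)%N) (co_ab : coprime a b).
Implicit Types s t : R.

Local Notation K := (harmonic_curve R a b (a%:Z * b%:Z - a%:Z - b%:Z)).

Lemma coprime_odd : odd a || odd b.
Proof.
rewrite -[_ || _]negbK negb_or; apply/negP => /andP[ea eb].
have : (2 %| gcdn a b)%N by rewrite dvdn_gcd !dvdn2 ea.
by rewrite (eqP co_ab).
Qed.

Lemma double_pointC s t : double_point K s t -> double_point K t s.
Proof. by case=> st xst yst; split; rewrite // eq_sym. Qed.

(** Beyond 1 a double point must have [s = - t]; then [a] and [b] are both even, against
    coprimality. *)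
Lemma double_point_norm_le1 s t : double_point K s t -> `|t| <= 1.
Proof.
case=> /eqP st xst yst; rewrite leNgt; apply/negP => t1.
have /eqP := normr_chebyshev_inj a_gt0 t1 xst.
rewrite eqr_norm2 => /orP[] /eqP // sE.
have ea : ~~ odd a by apply: (chebyshev_nat_eqN t1); rewrite -sE.
have eb : ~~ odd b by apply: (chebyshev_nat_eqN t1); rewrite -sE.
by have := coprime_odd; rewrite (negPf ea) (negPf eb).
Qed.

Definition partner_angle (u v : R) :=
  period2pi (a%:R * (v + u)) /\ period2pi (b%:R * (v - u)).

(** Each coordinate makes a multiple of [v + u] or of [v - u] a period. The same sign in both would
    give [cos v = cos u] by Bezout; the two mixed cases are exchanged by replacing [v] with
    [- v]. *)
Lemma double_point_angle s u : double_point K s (cos u) ->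
  exists2 v, s = cos v & partner_angle u v.
Proof.
move=> dp; have /double_point_norm_le1 := double_pointC dp.
rewrite ler_norml => /acos_def[_]; move: (acos s) => v sE; subst s.
case: dp => /eqP uv; rewrite /= !chebyshev_cos.
move=> /cos_eq_period; rewrite -mulrDr -mulrBr => xuv.
move=> /cos_eq_period; rewrite -mulrDr -mulrBr => yuv.
have Nuv : ~ period2pi (v + u).
  by move=> p; apply/uv/cos_eq_period; left.
have Nvu : ~ period2pi (v - u).
  by move=> p; apply/uv/cos_eq_period; right.
case: xuv yuv => xuv [] yuv.
- by case: Nuv; exact: period2pi_coprime xuv yuv.
- by exists v.
- exists (- v); first by rewrite cosN.
  split; first by rewrite addrC -opprB mulrN; exact: period2piN.
  by rewrite -opprD mulrN; exact: period2piN.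
- by case: Nvu; exact: period2pi_coprime xuv yuv.
Qed.

(** If [sin (a u) = 0], then [2 a u] is a period, so both [a (v - u)] and [b (v - u)] are, and the
    two parameters coincide. The case of [b] is the same with [v + u]. *)
Lemma partner_angle_sin_neq0 u v : partner_angle u v -> cos v <> cos u ->
  sin (a%:R * u) != 0 /\ sin (b%:R * u) != 0.
Proof.
move=> [pa pb] uv; split; apply/eqP => /sin_eq0_period p; apply/uv/cos_eq_period.
- right; apply: (period2pi_coprime co_ab) => //.
  have -> : a%:R * (v - u) = a%:R * (v + u) - (a%:R * u) *+ 2 by ring.
  exact: period2piB.
- left; apply: (period2pi_coprime co_ab) => //.
  have -> : b%:R * (v + u) = b%:R * (v - u) + (b%:R * u) *+ 2 by ring.
  exact: period2piD.
Qed.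

Lemma partner_angle_intpi u v : partner_angle u v ->
  exists k : int, (a * b)%:R * u = k%:~R * pi.
Proof.
(* Eliminating [v]: [2 a b u] is [b] times [a (v + u)] minus [a] times [b (v - u)]. *)
move=> [[m pm] [n pn]]; exists (m * b%:Z - n * a%:Z).
have pm2 : m%:~R * pi * 2 = a%:R * (v + u) by rewrite pm -mulr_natr; ring.
have pn2 : n%:~R * pi * 2 = b%:R * (v - u) by rewrite pn -mulr_natr; ring.
apply: (@mulIf _ 2); rewrite ?pnatr_eq0 //.
rewrite intrB !intrM natrM.
have -> : (m%:~R * b%:Z%:~R - n%:~R * a%:Z%:~R) * pi * 2 =
  b%:R * (m%:~R * pi * 2) - a%:R * (n%:~R * pi * 2) :> R by ring.
by rewrite pm2 pn2; ring.
Qed.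

Lemma height_gap (k : int) u v : partner_angle u v ->
    (a * b)%:R * u = k%:~R * pi ->
  (curve_z K).[cos u] - (curve_z K).[cos v] =
    (-1) ^+ `|k|%N.+1 * (2 * (sin (a%:R * u) * sin (b%:R * u))).
Proof.
move=> [pa pb]; rewrite natrM => kE; rewrite /= !chebyshev_cos !intrB intrM.
rewrite -![_%:Z%:~R]/(_%:R).
have -> : (a%:R * b%:R - a%:R - b%:R) * u =
  - (a%:R * u + b%:R * u) + k%:~R * pi by rewrite -kE; ring.
(* The last bracket is an integer combination of the two periods of the pair, so it drops out of the
   cosine. *)
have -> : (a%:R * b%:R - a%:R - b%:R) * v =
  (a%:R * u - b%:R * u + k%:~R * pi)
  + (a%:R * (b%:R * (v - u)) - a%:R * (v + u) - b%:R * (v - u)).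
  by rewrite -kE; ring.
rewrite (cosD_period (_ + k%:~R * pi)); last first.
  by apply: period2piB => //; apply: period2piB => //; exact: (@period2pi_intM R a).
by rewrite !cosD_intpi cosN cosB cosD exprS; ring.
Qed.

(** * Regularity of the projection: heights, transversality, triple points, immersion *)

Lemma double_point_height s t : double_point K s t ->
  (curve_z K).[s] != (curve_z K).[t].
Proof.
move=> dp; have := double_point_norm_le1 dp.
rewrite ler_norml => /acos_def[_]; move: (acos t) => u tE; subst t.
have [v sE uv] := double_point_angle dp; subst s.
have [k kE] := partner_angle_intpi uv.
have [/eqP st _ _] := dp.
have [sa sb] := partner_angle_sin_neq0 uv st.
rewrite eq_sym -subr_eq0 (height_gap uv kE).
by rewrite !mulf_neq0 ?signr_eq0 ?pnatr_eq0.
Qed.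

(** Modulo 2 pi, [a v] is [- a u] and [b v] is [b u]; the sign change in only one of them yields
    transversality. *)
Lemma partner_angle_sin u v : partner_angle u v ->
  sin (a%:R * v) = - sin (a%:R * u) /\ sin (b%:R * v) = sin (b%:R * u).
Proof.
move=> [pa pb]; split.
  by rewrite -sinN -(sinD_period (- _) pa); congr sin; ring.
by rewrite -[RHS](sinD_period _ pb); congr sin; ring.
Qed.

Lemma double_point_transverse s t : double_point K s t ->
  (curve_x K)^`().[s] * (curve_y K)^`().[t]
    != (curve_x K)^`().[t] * (curve_y K)^`().[s].
Proof.
move=> dp; have := double_point_norm_le1 dp.
rewrite ler_norml => /acos_def[_]; move: (acos t) => u tE; subst t.
have [v sE uv] := double_point_angle dp; subst s.
have [/eqP st _ _] := dp.
have [sa sb] := partner_angle_sin_neq0 uv st.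
have [ra rb] := partner_angle_sin uv.
have := deriv_chebyshev_cos a v; have := deriv_chebyshev_cos b u.
have := deriv_chebyshev_cos a u; have := deriv_chebyshev_cos b v.
rewrite ra rb /= /chebyshev !absz_nat.
set A := (_ a)^`().[cos u]; set A' := (_ a)^`().[cos v].
set B := (_ b)^`().[cos u]; set B' := (_ b)^`().[cos v] => h1 h2 h3 h4.
(* After multiplication by [sin v * sin u] the two sides are opposite, equal up to sign to
   [a b sin (a u) sin (b u)], which is nonzero. *)
apply/eqP => /(congr1 (fun x : R => x * (sin v * sin u))) /=.
rewrite mulrACA h3 h4 [sin v * _]mulrC [RHS]mulrACA h1 h2 => e.
have : (a%:R * b%:R) * (sin (a%:R * u) * sin (b%:R * u)) == 0 by apply/eqP; lra.
by rewrite !mulf_eq0 !pnatr_eq0 (negPf sa) (negPf sb) !gtn_eqF.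
Qed.

(** Subtracting the relations of [v] and [v'] to the common [u] makes [a (v - v')] and [b (v - v')]
    periods. *)
Lemma double_point_unique s s' t :
  double_point K s t -> double_point K s' t -> s = s'.
Proof.
move=> dp dp'; have := double_point_norm_le1 dp.
rewrite ler_norml => /acos_def[_]; move: (acos t) => u tE; subst t.
have [v sE [pa pb]] := double_point_angle dp.
have [v' sE' [pa' pb']] := double_point_angle dp'.
have p : period2pi (v - v').
  apply: (period2pi_coprime co_ab).
    by have := period2piB pa pa'; rewrite -mulrBr opprD addrACA subrr addr0.
  by have := period2piB pb pb'; rewrite -mulrBr opprD addrACA subrr addr0.
by rewrite sE sE'; apply/cos_eq_period; right.
Qed.

Lemma harmonic_immersed t :
  ~ ((curve_x K)^`().[t] = 0 /\ (curve_y K)^`().[t] = 0).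
Proof.
rewrite /= /chebyshev !absz_nat => -[da db].
have t1 : `|t| < 1.
  rewrite ltNge; apply/negP => t1.
  by have := deriv_chebyshev_neq0 a_gt0 t1; rewrite da eqxx.
have tI : -1 <= t <= 1 by rewrite -ler_norml ltW.
have [_] := acos_def tI; move: (acos t) => u tE; subst t.
have := deriv_chebyshev_cos a u; rewrite da mul0r => /esym/eqP.
rewrite mulf_eq0 pnatr_eq0 gtn_eqF //= => /eqP/sin_eq0_period sa.
have := deriv_chebyshev_cos b u; rewrite db mul0r => /esym/eqP.
rewrite mulf_eq0 pnatr_eq0 gtn_eqF //= => /eqP/sin_eq0_period sb.
(* Both [sin (a u)] and [sin (b u)] vanish, so Bezout gives [sin u = 0], that is [|t| = 1], which
   was excluded. *)
have : sin u = 0.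
  apply/sin_eq0_period/(period2pi_coprime co_ab); first by rewrite mulrnAr.
  by rewrite mulrnAr.
by move=> /sin0cos1 u1; rewrite u1 ltxx in t1.
Qed.

(** * Enumeration of the crossing parameters *)

Definition crossing_index k := [&& (k < a * b)%N, ~~ (a %| k)%N & ~~ (b %| k)%N].

Definition crossing_angle k : R := k%:R * (pi / (a * b)%:R).

Lemma crossing_angleK k : (a * b)%:R * crossing_angle k = k%:R * pi.
Proof. by rewrite mulrCA [(a * b)%:R * _]mulrC divfK // pnatr_eq0 muln_eq0 !gtn_eqF. Qed.

Lemma crossing_angle_mull k : a%:R * crossing_angle k = k%:R * (pi / b%:R).
Proof. by rewrite /crossing_angle natrM; field; rewrite !pnatr_eq0 !gtn_eqF. Qed.

Lemma crossing_angle_mulr k : b%:R * crossing_angle k = k%:R * (pi / a%:R).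
Proof. by rewrite /crossing_angle natrM; field; rewrite !pnatr_eq0 !gtn_eqF. Qed.

Lemma crossing_angle_itv k : (k <= a * b)%N -> crossing_angle k \in `[0, pi].
Proof.
move=> kab; have ab0 : 0 < (a * b)%:R :> R by rewrite ltr0n muln_gt0 a_gt0.
rewrite in_itv /= /crossing_angle mulrA ler_pdivrMr // divr_ge0 ?mulr_ge0 ?pi_ge0 //=.
by rewrite mulrC ler_wpM2l ?pi_ge0 // ler_nat.
Qed.

(** The cosine decreases on [0, pi], so travelling along the curve with increasing t meets the
    indices in decreasing order. *)
Lemma crossing_param_lt j k : (j <= a * b)%N -> (k <= a * b)%N ->
  (cos (crossing_angle j) < cos (crossing_angle k)) = (k < j)%N.
Proof.
move=> jab kab; rewrite ltr_cos ?crossing_angle_itv // ltr_pM2r ?ltr_nat //.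
by rewrite divr_gt0 ?pi_gt0 // ltr0n muln_gt0 a_gt0.
Qed.

(** Euclidean division: the remainder gives an angle strictly between 0 and pi, and each unit of the
    quotient shifts by pi and flips the sign. *)
Lemma sin_pi_frac n k : (0 < n)%N -> ~~ (n %| k)%N ->
  exists2 p : R, 0 < p & sin (k%:R * (pi / n%:R)) = (-1) ^+ (k %/ n) * p.
Proof.
move=> n0 nk; have n0R : 0 < n%:R :> R by rewrite ltr0n.
exists (sin ((k %% n)%:R * (pi / n%:R))).
  apply: sin_gt0_pi; rewrite mulr_gt0 ?divr_gt0 ?pi_gt0 ?ltr0n //= ?lt0n //.
  by rewrite mulrCA gtr_pMr ?pi_gt0 // ltr_pdivrMr // mul1r ltr_nat ltn_mod.
rewrite -sinD_natpi; congr sin.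
by rewrite {1}(divn_eq k n) natrD natrM; field; rewrite pnatr_eq0 gtn_eqF.
Qed.

Lemma sin_crossing_angle k : crossing_index k ->
  sin (a%:R * crossing_angle k) != 0 /\ sin (b%:R * crossing_angle k) != 0.
Proof.
case/and3P=> _ ak bk; rewrite crossing_angle_mull crossing_angle_mulr.
have [p p0 ->] := sin_pi_frac a_gt0 ak; have [q q0 ->] := sin_pi_frac b_gt0 bk.
by rewrite !mulf_neq0 ?signr_eq0 ?gt_eqF.
Qed.

Lemma crossing_index_double k : crossing_index k ->
  exists s, double_point K s (cos (crossing_angle k)).
Proof.
move=> /sin_crossing_angle[sa sb]; set u := crossing_angle k in sa sb *.
have [[x y] /= xy] : exists uv, uv.1 * a%:Z + uv.2 * b%:Z = 1.
  by apply/coprimezP.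
have kE : k%:R * pi = a%:R * b%:R * u by rewrite -natrM crossing_angleK.
have pk (z : int) : period2pi (z%:~R * (k%:R * pi) *+ 2 : R).
  by exists (z * k%:Z); rewrite intrM; ring.
(* With [x a + y b = 1] this choice gives [v + u = 2 y b u] and [v - u = - 2 x a u]; as
   [a b u = k pi], both required multiples are periods. *)
pose v := (y%:~R * b%:R - x%:~R * a%:R) * u.
have uE : u = (x%:~R * a%:R + y%:~R * b%:R) * u.
  by rewrite -[a%:R]/(a%:~R) -[b%:R]/(b%:~R) -!intrM -intrD xy mul1r.
have pa : period2pi (a%:R * (v + u)).
  by have := pk y; rewrite kE [u in v + u]uE /v; congr period2pi; ring.
have pb : period2pi (b%:R * (v - u)).
  by have := pk (- x); rewrite kE [u in v - u]uE /v intrN; congr period2pi; ring.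
exists (cos v); split=> /=.
(* If [v + u] were a period, so would be [2 b u]; if [v - u] were, so would be [2 a u]. Neither sine
   vanishes at a crossing index. *)
- apply/eqP => /cos_eq_period[] p.
    move/negP: sb; apply; apply/eqP/sin_eq0_period.
    have -> : b%:R * u *+ 2 = b%:R * (v + u) - b%:R * (v - u) by ring.
    by apply: period2piB => //; exact: (@period2pi_intM R b).
  move/negP: sa; apply; apply/eqP/sin_eq0_period.
  have -> : a%:R * u *+ 2 = a%:R * (v + u) - a%:R * (v - u) by ring.
  by apply: period2piB => //; exact: (@period2pi_intM R a).
- rewrite !chebyshev_cos -[a%:~R]/(a%:R).
  by rewrite -[RHS]cosN -(cosD_period (- _) pa); congr cos; ring.
- rewrite !chebyshev_cos -[b%:~R]/(b%:R).
  by rewrite -[RHS](cosD_period _ pb); congr cos; ring.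
Qed.

Lemma crossing_paramsP t : crossing_params K t <->
  exists2 k, crossing_index k & t = cos (crossing_angle k).
Proof.
split=> [[s dp]|[k ki ->]]; last exact: crossing_index_double.
have := double_point_norm_le1 dp.
rewrite ler_norml => /acos_def[]; move: (acos t) => u uI tE; subst t.
have [v sE uv] := double_point_angle dp; subst s.
have [z zE] := partner_angle_intpi uv.
have [/eqP st _ _] := dp.
have [sa sb] := partner_angle_sin_neq0 uv st.
have ab0 : 0 < (a * b)%:R :> R by rewrite ltr0n muln_gt0 a_gt0.
have pi0 := pi_gt0 R; case/andP: uI => u0 u1.
have z0 : 0 <= z.
  by rewrite -(ler0z R) -(pmulr_lge0 _ pi0) -zE mulr_ge0 // ltW.
case: z z0 zE => // k _; rewrite -[k%:~R]/(k%:R) => kE.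
have uE : u = crossing_angle k.
  by apply: (mulfI (lt0r_neq0 ab0)); rewrite kE crossing_angleK.
exists k; last by rewrite uE.
have kab : (k <= a * b)%N.
  by rewrite -(ler_nat R) -(ler_pM2r pi0) -kE ler_wpM2l // ltW.
(* The roles cross over: [b u = k pi / a], so a multiple of [a] would kill [sin (b u)], and a
   multiple of [b] would kill [sin (a u)]. *)
have ak : ~~ (a %| k)%N.
  apply: contra sb => /dvdnP[q qE]; rewrite uE crossing_angle_mulr qE natrM.
  rewrite -mulrA [a%:R * _]mulrC divfK ?pnatr_eq0 ?gtn_eqF //.
  by rewrite (@sin_intpi R q).
have bk : ~~ (b %| k)%N.
  apply: contra sa => /dvdnP[q qE]; rewrite uE crossing_angle_mull qE natrM.
  rewrite -mulrA [b%:R * _]mulrC divfK ?pnatr_eq0 ?gtn_eqF //.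
  by rewrite (@sin_intpi R q).
(* The endpoint [k = a b] is a multiple of [a], which makes the bound strict. *)
rewrite /crossing_index ak bk !andbT ltn_neqAle kab andbT.
by apply: contra ak => /eqP ->; exact: dvdn_mulr.
Qed.

Lemma finite_crossing_params : finite_set (crossing_params K).
Proof.
apply: (@sub_finite_set _ _ ((fun k => cos (crossing_angle k)) @` `I_(a * b))).
  by move=> t /crossing_paramsP[k /and3P[kab _ _] ->]; exists k.
exact: finite_image (finite_II _).
Qed.

Lemma harmonic_regular : regular_diagram K.
Proof.
split; [exact: harmonic_immersed | exact: finite_crossing_params
  | exact: double_point_unique | exact: double_point_transverse
  | exact: double_point_height].
Qed.

(** * Parity of the crossings and alternation *)

Definition crossing_parity k := odd (k + k %/ a + k %/ b).

Lemma crossing_height_gap k s : crossing_index k ->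
    double_point K s (cos (crossing_angle k)) ->
  exists2 p : R, 0 < p & (curve_z K).[cos (crossing_angle k)] - (curve_z K).[s]
    = (-1) ^+ (~~ crossing_parity k) * p.
Proof.
move=> /and3P[_ ak bk] dp; have [v -> uv] := double_point_angle dp.
rewrite (@height_gap k _ _ uv (crossing_angleK k)) crossing_angle_mull crossing_angle_mulr.
have [p p0 ->] := sin_pi_frac a_gt0 ak; have [q q0 ->] := sin_pi_frac b_gt0 bk.
exists (2 * (q * p)); first by rewrite !mulr_gt0.
(* The extra sign of [height_gap] adds one to the exponent, hence the negated parity. *)
rewrite /crossing_parity -oddS signr_odd absz_nat !exprS !exprD; ring.
Qed.

Lemma over_at_crossing k : crossing_index k ->
  over_at K (cos (crossing_angle k)) <-> crossing_parity k.
Proof.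
move=> ki; have [s dp] := crossing_index_double ki; split=> [[s' dp'] zlt|par].
  have [p p0] := crossing_height_gap ki dp'.
  by case: crossing_parity => //; rewrite expr1; lra.
have [p p0] := crossing_height_gap ki dp; rewrite par expr0 => zE.
by exists s => //; lra.
Qed.

Lemma under_at_crossing k : crossing_index k ->
  under_at K (cos (crossing_angle k)) <-> ~~ crossing_parity k.
Proof.
move=> ki; have [s dp] := crossing_index_double ki; split=> [[s' dp'] zlt|par].
  have [p p0] := crossing_height_gap ki dp'.
  by case: crossing_parity => //; rewrite expr0; lra.
have [p p0] := crossing_height_gap ki dp; rewrite par expr1 => zE.
by exists s => //; lra.
Qed.

(** A quotient grows by one exactly at multiples of its divisor. Strictly between 0 and [a b] no
    number is a multiple of both, so the sum grows by 2 at a multiple of one and by 1 at a crossing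
    index. *)
Lemma crossing_parityS k : (k.+1 < a * b)%N ->
  crossing_parity k.+1 = crossing_parity k (+) crossing_index k.+1.
Proof.
move=> kab; rewrite /crossing_parity !divnS // /crossing_index kab /= !oddD /=.
have Nab : ~~ ((a %| k.+1) && (b %| k.+1))%N.
  by rewrite -Gauss_dvd //; apply: contraL kab => /dvdn_leq; rewrite -leqNgt; exact.
by move: Nab; case: (a %| _)%N; case: (b %| _)%N => //= _;
  case: odd; case: odd; case: odd.
Qed.

Lemma crossing_parity_gap j k : (j <= k)%N -> (k < a * b)%N ->
    (forall i, (j < i <= k)%N -> ~~ crossing_index i) ->
  crossing_parity k = crossing_parity j.
Proof.
elim: k => [|k IH]; first by rewrite leqn0 => /eqP ->.
rewrite leq_eqVlt ltnS => /orP[/eqP -> //|jk] kab gap.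
rewrite crossing_parityS // (negPf (gap _ _)) ?ltnS ?jk ?leqnn // addbF.
by apply: IH (ltnW kab) _ => // i /andP[ji ik]; apply: gap; rewrite ji leqW.
Qed.

Lemma crossing_parity_next j k : (j < k)%N -> crossing_index k ->
    (forall i, (j < i < k)%N -> ~~ crossing_index i) ->
  crossing_parity k = ~~ crossing_parity j.
Proof.
case: k => // k; rewrite ltnS => jk ki gap; have /and3P[kab _ _] := ki.
rewrite crossing_parityS // ki addbT.
by rewrite (crossing_parity_gap jk (ltnW kab)).
Qed.

Lemma crossing_parity0 : crossing_parity 0 = false.
Proof. by rewrite /crossing_parity !div0n. Qed.

(** The quotients of [a b - 1] by [a] and [b] are [b - 1] and [a - 1], so the sum is (a + 1)(b + 1)
    - 4, which is even because [a] or [b] is odd. *)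
Lemma crossing_parity_last : crossing_parity (a * b).-1 = false.
Proof.
have ab0 : (0 < a * b)%N by rewrite muln_gt0 a_gt0.
have := divnS (a * b).-1 a_gt0; have := divnS (a * b).-1 b_gt0.
rewrite prednK // mulnK // mulKn // [(b %| _)%N]dvdn_mull // [(a %| _)%N]dvdn_mulr //.
move=> /(congr1 odd) + /(congr1 odd); rewrite /crossing_parity !oddD /= => Ea Eb.
have := congr1 odd (prednK ab0); rewrite /= oddM => Eab.
move: Eab; rewrite Ea Eb; move: coprime_odd; rewrite Ea Eb.
by do 3![case: odd].
Qed.

Lemma harmonic_alternating : Defs.alternating K.
Proof.
move=> t t' [/crossing_paramsP[k ki ->] /crossing_paramsP[k' ki' ->] gap].
have /and3P[kab _ _] := ki; have /and3P[kab' _ _] := ki'.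
rewrite over_at_crossing // under_at_crossing //.
have {}gap i : crossing_index i ->
    ~~ on_arc (cos (crossing_angle k)) (cos (crossing_angle k'))
        (cos (crossing_angle i)).
  by move=> ii; apply/gap/crossing_paramsP; exists i.
move: gap; rewrite /on_arc crossing_param_lt ?(ltnW kab) ?(ltnW kab') //.
case: ltnP => [kk|kk] gap.
  (* On an arc avoiding infinity, [k'] is the crossing index just below [k]. *)
  rewrite (crossing_parity_next kk) // => i /andP[ik ik'].
  apply/negP => ii; have /and3P[iab _ _] := ii.
  by have := gap i ii; rewrite !crossing_param_lt ?ik ?ik' // ltnW.
(* On the arc through infinity, [k] is the least crossing index and [k'] the greatest; their
   parities are compared with those at 0 and at [a b - 1]. *)
have {}gap i : crossing_index i -> ~~ ((i < k) || (k' < i))%N.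
  move=> ii; have /and3P[iab _ _] := ii.
  by have := gap i ii; rewrite !crossing_param_lt // ltnW.
have k0 : (0 < k)%N by case: (k) ki => //; rewrite /crossing_index dvdn0 andbF.
have -> : crossing_parity k.
  rewrite (crossing_parity_next k0) ?crossing_parity0 // => i /andP[_ ik].
  by apply/negP => /gap; rewrite ik.
have -> : crossing_parity k' = false.
  have ab0 : (0 < a * b)%N by apply: leq_ltn_trans kab.
  rewrite -crossing_parity_last; apply/esym/crossing_parity_gap.
  - by rewrite -ltnS prednK.
  - by rewrite prednK.
  - by move=> i /andP[ik _]; apply/negP => /gap; rewrite ik orbT.
by [].
Qed.

End HarmonicDiagram.

Theorem theorem1 (R : realType) (a b : int) (ha : 0 < a) (hb : 0 < b)
    (hab : coprimez a b) :
  alternating_diagram (harmonic_curve R a b (a * b - a - b)).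
Proof.
case: a ha hab => // a a0; case: b hb => // b b0 ab.
by split; [exact: harmonic_regular | exact: harmonic_alternating].
Qed.
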